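(* Let $(X,d)$ be a compact metric space and let $(X,\mathbb{F})$ be the non-autonomous dynamical system generated by a family $\mathbb{F}=\{f_n:n\in\mathbb{N}\}$ of homeomorphisms of $X$ (not assumed to commute). Then $(X,\mathbb{F})$ is minimal if and only if for every non-empty open set $U$ in $X$ there exists $k\in\mathbb{N}$ such that $\mathcal{O}_H^k(x)\cap U\neq\emptyset$ for all $x\in X$.
   Context: $\mathbb{N}=\{1,2,3,\dots\}$. The non-autonomous system $(X,\mathbb{F})$ has time-$n$ states $\omega_n(x)$, $n\in\mathbb{Z}$, defined by $\omega_0(x)=x$, $\omega_n(x)=f_n(\omega_{n-1}(x))$ for $n\ge 1$, and $\omega_n(x)=f_{-n}^{-1}(\omega_{n+1}(x))$ for $n<0$; thus $\omega_n=f_n\circ\cdots\circ f_1$ and $\omega_{-n}=f_n^{-1}\circ\cdots\circ f_1^{-1}$ for $n\geq 1$. For $k\in\mathbb{N}$, the truncation of order $k$ of the orbital hull of $x$ is $\mathcal{O}_H^k(x)=\{(\omega_{r_n}\circ\omega_{r_{n-1}}\circ\cdots\circ\omega_{r_1})(x): n\in\mathbb{N},\ r_i\in\{-k,-k+1,\dots,k\}\}$ (the length $n$ is arbitrary). A set $Y\subseteq X$ is invariant if $\omega_k(Y)\subseteq Y$ for all $k\in\mathbb{Z}$. $(X,\mathbb{F})$ is minimal if $X$ is non-empty and no proper non-empty subset of $X$ is closed and invariant.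
   Formalization: The space X is assumed non-empty: for X empty the condition on open sets holds vacuously, while minimality by definition requires X to be non-empty, so the equivalence fails in that case only. *)

(* Defs.v *)
From HB Require Import structures.
From mathcomp Require Import all_boot all_order all_algebra.
From mathcomp Require Import boolp classical_sets functions reals topology.

Set Implicit Arguments.
Unset Strict Implicit.
Unset Printing Implicit Defensive.

Import Order.TTheory GRing.Theory Num.Theory.

Local Open Scope classical_set_scope.
Local Open Scope ring_scope.

Definition homeomorphism (X Y : topologicalType)
    (h : {splitbij [set: X] >-> [set: Y]}) : Prop :=
  continuous h /\ continuous h^-1%FUN.

(* The family (f_n) is indexed from n = 1: the value [f 0] is never used.
   Since [iteri n.+1 g x] unfolds to [g n (iteri n g x)],
     omega f n    = f_n o ... o f_1   and   omega f (- n) = f_n^-1 o ... o f_1^-1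
   (note the order of the factors: the latter is not the inverse of the
   former in general). *)
Definition omega (X : topologicalType)
    (f : nat -> {splitbij [set: X] >-> [set: X]}) (k : int) (x : X) : X :=
  match k with
  | Posz n => iteri n (fun i => f i.+1) x
  | Negz n => iteri n.+1 (fun i => ((f i.+1)^-1)%FUN) x
  end.

Lemma omega0 (X : topologicalType)
    (f : nat -> {splitbij [set: X] >-> [set: X]}) (x : X) :
  omega f 0 x = x.
Proof. by []. Qed.

Lemma omega_pos (X : topologicalType)
    (f : nat -> {splitbij [set: X] >-> [set: X]}) (n : nat) (x : X) :
  (0 < n)%N -> omega f n%:Z x = f n (omega f (n%:Z - 1) x).
Proof. by case: n => // n _; have -> : n.+1%:Z - 1 = n%:Z by rewrite -addn1 PoszD addrK. Qed.

Lemma omega_neg (X : topologicalType)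
    (f : nat -> {splitbij [set: X] >-> [set: X]}) (n : nat) (x : X) :
  (0 < n)%N -> omega f (- n%:Z) x = ((f n)^-1)%FUN (omega f (- n%:Z + 1) x).
Proof.
case: n => // n _; have -> : - n.+1%:Z + 1 = - n%:Z.
  by rewrite -addn1 PoszD opprD addrNK.
by case: n.
Qed.

(* The word r = [:: r_1; ...; r_n] is nonempty and its head acts first. *)
Definition orbital_hull (X : topologicalType)
    (f : nat -> {splitbij [set: X] >-> [set: X]}) (k : nat) (x : X) : set X :=
  [set y | exists r : seq int,
    [/\ (0 < size r)%N,
        all (fun i : int => - k%:Z <= i <= k%:Z) r &
        y = foldl (fun z i => omega f i z) x r]].

Definition invariant_set (X : topologicalType)
    (f : nat -> {splitbij [set: X] >-> [set: X]}) (Y : set X) : Prop :=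
  forall k : int, omega f k @` Y `<=` Y.

Definition minimal_system (X : topologicalType)
    (f : nat -> {splitbij [set: X] >-> [set: X]}) : Prop :=
  [set: X] !=set0 /\
  ~ exists Y : set X,
      [/\ Y `<` [set: X], Y !=set0, closed Y & invariant_set f Y].

(* Main.v *)
Require Import Defs.
From mathcomp Require Import all_boot all_order all_algebra.
From mathcomp Require Import boolp classical_sets functions reals topology.
From mathcomp Require Import zify.

Set Implicit Arguments.
Unset Strict Implicit.
Unset Printing Implicit Defensive.

Local Open Scope classical_set_scope.
Local Open Scope ring_scope.

(* The points whose order-k hull meets the open set U form an open set,
   nondecreasing in k.  The points lying in none of these sets form a closed
   invariant set disjoint from U, which minimality forces to be empty; so these
   open sets cover X and, by compactness, one of them is X.  Conversely, the
   hull of a point of a closed invariant set Y never enters the open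
   complement of Y. *)

Lemma omega_continuous (X : topologicalType)
    (f : nat -> {splitbij [set: X] >-> [set: X]})
    (f_homeo : forall n : nat, (1 <= n)%N -> homeomorphism (f n)) (i : int) :
  continuous (omega f i).
Proof.
have iteri_cont (g : nat -> X -> X) n :
    (forall j, continuous (g j)) -> continuous (iteri n g).
  move=> g_cont; elim: n => [|n IHn] x //=.
  by apply: (@continuous_comp _ _ _ (iteri n g)); [exact: IHn | exact: g_cont].
(* The two cases iterate the maps [f j.+1] and their inverses; a homeomorphism makes both
   continuous. *)
by case: i => n; apply: iteri_cont => j; have [] := f_homeo j.+1 isT.
Qed.

Lemma foldl_continuous (T : topologicalType) (I : Type) (g : I -> T -> T)
    (r : seq I) :
  (forall i, continuous (g i)) -> continuous (fun x => foldl (fun z i => g i z) x r).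
Proof.
move=> g_cont; elim: r => [|i r IHr] x //=.
apply: (@continuous_comp _ _ _ (g i) (fun y => foldl (fun z j => g j z) y r)).
  exact: g_cont.
exact: IHr.
Qed.

Lemma orbital_hull_subset (X : topologicalType)
    (f : nat -> {splitbij [set: X] >-> [set: X]}) (k l : nat) (x : X) :
  (k <= l)%N -> orbital_hull f k x `<=` orbital_hull f l x.
Proof.
move=> le_kl y [r [r_gt0 r_k ->]]; exists r; split=> //.
by apply: sub_all r_k => i; lia.
Qed.

(** Words must be nonempty, so the one-letter word [0], admissible even for [k = 0], plays the
    identity. *)
Lemma orbital_hull_id (X : topologicalType)
    (f : nat -> {splitbij [set: X] >-> [set: X]}) (k : nat) (x : X) :
  orbital_hull f k x x.
Proof. by exists [:: 0]; split=> //=; lia. Qed.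

(** Prepending the letter [i] turns a word acting on [omega f i x] into one acting on [x]; the order
    grows to admit [i]. *)
Lemma orbital_hull_omega (X : topologicalType)
    (f : nat -> {splitbij [set: X] >-> [set: X]}) (k : nat) (i : int) (x : X) :
  orbital_hull f k (omega f i x) `<=` orbital_hull f (maxn k `|i|) x.
Proof.
move=> y [r [r_gt0 r_k ->]]; exists (i :: r); split=> //=.
apply/andP; split; first lia.
by apply: sub_all r_k => j; lia.
Qed.

Lemma orbital_hull_invariant (X : topologicalType)
    (f : nat -> {splitbij [set: X] >-> [set: X]}) (Y : set X) (k : nat) (x : X) :
  invariant_set f Y -> Y x -> orbital_hull f k x `<=` Y.
Proof.
move=> Y_inv Yx y [r [_ _ ->]]; elim: r x Yx => //= i r IHr x Yx.
by apply: IHr; apply: (Y_inv i); exists x.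
Qed.

(** A word that sends [x] into [U] acts continuously, so the same word sends all points near [x]
    into [U]. *)
Lemma orbital_hull_meets_open (X : topologicalType)
    (f : nat -> {splitbij [set: X] >-> [set: X]}) (U : set X) (k : nat)
    (f_homeo : forall n : nat, (1 <= n)%N -> homeomorphism (f n)) :
  open U -> open [set x | orbital_hull f k x `&` U !=set0].
Proof.
move=> U_open; rewrite openE => x [_ [[r [r_gt0 r_k ->]] Ux]].
have word_cont := @foldl_continuous _ _ (omega f) r (omega_continuous f_homeo).
have U_near : \forall y \near x, U (foldl (fun z i => omega f i z) y r).
  exact: (word_cont x U (open_nbhs_nbhs (conj U_open Ux))).
rewrite /interior; apply: filterS U_near => y Uy.
by exists (foldl (fun z i => omega f i z) y r); split=> //; exists r.
Qed.

Lemma minimal_hull_meets (X : topologicalType)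
    (f : nat -> {splitbij [set: X] >-> [set: X]}) (U : set X)
    (f_homeo : forall n : nat, (1 <= n)%N -> homeomorphism (f n)) (x : X) :
  minimal_system f -> open U -> U !=set0 ->
  exists k, orbital_hull f k x `&` U !=set0.
Proof.
move=> [_ f_min] U_open [u Uu]; apply: contrapT => x_far; apply: f_min.
pose W k := [set x | orbital_hull f k x `&` U !=set0].
exists (~` \bigcup_k W k); split.
(* Properness: [u] is in its own hull and in [U], hence in [W 0]. *)
- split=> // /(_ u I); apply; exists 0%N => //.
  by exists u; split=> //; exact: orbital_hull_id.
- by exists x => -[k _ Wkx]; apply: x_far; exists k.
- by apply/open_closedC/bigcup_open => k _; exact: orbital_hull_meets_open.
(* Invariance by contraposition: if a hull of [omega f i y] meets [U], so does a larger hull of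
   [y]. *)
- move=> i _ [y Yy <-] [k _ [z [hz Uz]]]; apply: Yy.
  by exists (maxn k `|i|) => //; exists z; split=> //; exact: orbital_hull_omega hz.
Qed.

Theorem proposition3 (R : realType) (X : metricType R)
    (f : nat -> {splitbij [set: X] >-> [set: X]})
    (X_nonempty : [set: X] !=set0)
    (X_compact : compact [set: X])
    (f_homeo : forall n : nat, (1 <= n)%N -> homeomorphism (f n)) :
  minimal_system f <->
  (forall U : set X, open U -> U !=set0 ->
    exists2 k : nat, (1 <= k)%N &
      forall x : X, orbital_hull f k x `&` U !=set0).
Proof.
split=> [f_min U U_open U_neq0 | hull_meets].
  have /compact_near_coveringP X_cover := X_compact.
  (* Near-covering form of compactness: a property holding near each point for all large [k] holds
     on all of [X] for large [k]. *)
  have := X_cover nat \oo (fun k x => orbital_hull f k x `&` U !=set0) _.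
  case=> [x _ | N _ hN]; last first.
    (* The threshold [N] may be 0; its successor is a positive order. *)
    by exists N.+1 => // x; apply: (hN N.+1) => //=.
  have [k kx] := minimal_hull_meets f_homeo x f_min U_open U_neq0.
  exists ([set y | orbital_hull f k y `&` U !=set0], [set l | (k <= l)%N]).
    split; last by exists k.
    by apply: open_nbhs_nbhs; split=> //; exact: orbital_hull_meets_open.
  move=> [y l] /= [[z [hz Uz]] le_kl].
  by exists z; split=> //; exact: orbital_hull_subset hz.
split=> // -[Y [[_ YnT] [x Yx] Y_closed Y_inv]].
(* The open set to test is the complement of [Y], nonempty because [Y] is proper. *)
have [|k _ /(_ x) [y [hy]]] := hull_meets (~` Y) (closed_openC Y_closed).
  by apply: contrapT => YC0; apply: YnT => y _; apply: contrapT => Yy; apply: YC0; exists y.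
by apply; exact: orbital_hull_invariant hy.
Qed.
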